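(* For every real $c>0$ and every integer $t\ge 2$ there exists a constant $\mu_t=\mu_t(c)>0$ such that the following holds. Let $A$ be a finite abelian group (written multiplicatively) with $|A|=n$, and let $S_0\subseteq\{(a,b,ab): a,b\in A\}\subseteq A^3$ be a set of triples with $|S_0|\ge cn^2$. Then $S_0$ contains at least $\lfloor \mu_t n^3\rfloor$ distinct configurations, each of which is a $\left(\nu,\ \frac{4(\nu-3t)}{3}\left(1-\frac1{4^t}\right)\right)$-configuration for some integer $\nu$ (which may depend on the configuration) with $2^{t+1}\le \nu\le 4^t+3t$.
   Context: Let $A$ be a finite group and $S\subseteq\{(a,b,ab):a,b\in A\}$. For an integer $m$ and a real number $k$, an $(m,k)$-configuration in $S$ is a set $T\subseteq S$ consisting of at least $k$ distinct triples on $m$ elements of $A$, i.e. such that the set of all elements of $A$ occurring as a coordinate of some triple in $T$ has exactly $m$ elements. (Coordinates are regarded as elements of the single set $A$.) Configurations are counted as distinct sets of triples $T$. *)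

(* Defs.v *)
From HB Require Import structures.
From mathcomp Require Import all_boot all_order all_algebra all_fingroup.
From mathcomp Require Import reals.
Set Implicit Arguments.
Unset Strict Implicit.
Unset Printing Implicit Defensive.
Import Order.TTheory GRing.Theory Num.Theory.
Local Open Scope ring_scope.

(* The group is the whole type [A]; a triple (a, b, c) is ((a, b), c). *)
Notation triple A := (A * A * A)%type.

Definition mul_triples (A : finGroupType) : {set triple A} :=
  [set (ab.1, ab.2, (ab.1 * ab.2)%g) | ab : A * A].

(* All three coordinates are pooled into the single set [A], so an element
   occurring in different positions is counted once. *)
Definition elements (A : finGroupType) (T : {set triple A}) : {set A} :=
  \bigcup_(s in T) [set s.1.1; s.1.2; s.2].

Definition is_configuration (R : realType) (A : finGroupType)
    (S : {set triple A}) (m : nat) (k : R) (T : {set triple A}) : Prop :=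
  [/\ T \subset S, #|elements T| = m & k <= #|T|%:R].

(* Main.v *)
Require Import Defs.
From HB Require Import structures.
From mathcomp Require Import all_boot all_order all_algebra all_fingroup.
From mathcomp Require Import reals.
From mathcomp Require Import ring lra zify.
Set Implicit Arguments.
Unset Strict Implicit.
Unset Printing Implicit Defensive.
Import Order.TTheory GRing.Theory Num.Theory.
Local Open Scope ring_scope.

(* Write the group additively. If x_1..x_r, y_1..y_r, d_1..d_m are such that all
   triples (x_i + d_k, y_j - d_k, x_i + y_j) lie in S0, then these r^2 m triples
   span at most 2rm + r^2 elements, because the sum x_i + y_j does not depend on
   k. Three applications of the power mean inequality, cloning d, then x, then y,
   show that a proportion at least c^(r^2 m) of all parameters has this property,
   and only O(1/n) of them have collisions among the elements x_i + d_k and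
   y_j - d_k. The sizes r = m = 2 for t = 2, and r = 3, m = 2^t for t >= 3, meet
   the required bounds. For small n, mu is chosen so that mu n^3 < 1. *)

(** * Power mean inequality and cloning of a variable *)

(** Convexity: a power lies above its tangent at [a]. In the induction the new gap is [z] times the
    old one plus [(m + 1) * a ^ m * (z - a) ^ 2]. *)
Lemma expr_tangent (R : realFieldType) (a z : R) (m : nat) :
  0 <= a -> 0 <= z -> m.+1%:R * a ^+ m * z <= z ^+ m.+1 + m%:R * a ^+ m.+1.
Proof.
move=> a0 z0; elim: m => [|m IH]; first by rewrite expr0 expr1 !mul1r mul0r addr0.
have := ler_wpM2l z0 IH; have := exprn_ge0 m a0; have := ler0n R m.
rewrite !exprS -[m.+2]addn2 -[m.+1]addn1 !natrD.
set b := a ^+ m; set w := z ^+ m; set k : R := m%:R => k0 b0 H.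
have h : 0 <= (k + 1) * b * (z - a) ^+ 2.
  by rewrite mulr_ge0 ?sqr_ge0 ?mulr_ge0 ?addr_ge0.
rewrite -subr_ge0; move: H; rewrite -subr_ge0 => H.
by apply: le_trans (addr_ge0 h H) _; rewrite le_eqVlt; apply/orP; left; apply/eqP; ring.
Qed.

(** The tangent is taken at [a] and not at the mean of [f], so a lower bound on the mean is
    enough. *)
Lemma sum_expr_ge (R : realFieldType) (I : finType) (f : I -> R) (a : R) (m : nat) :
  0 <= a -> (forall i, 0 <= f i) -> a * #|I|%:R <= \sum_i f i ->
  a ^+ m * #|I|%:R <= \sum_i f i ^+ m.
Proof.
move=> a0 f0 le_af; case: m => [|m].
  by rewrite expr0 mul1r (eq_bigr (fun=> 1)) // sumr_const.
have : \sum_i (m.+1%:R * a ^+ m * f i) <= \sum_i (f i ^+ m.+1 + m%:R * a ^+ m.+1).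
  by apply: ler_sum => i _; apply: expr_tangent.
rewrite big_split /= sumr_const -mulr_sumr -[_ *+ #|_|]mulr_natr => H.
have h : m.+1%:R * a ^+ m * (a * #|I|%:R) <= m.+1%:R * a ^+ m * \sum_i f i.
  by rewrite ler_wpM2l // mulr_ge0 ?exprn_ge0.
have := le_trans h H; rewrite -lerBlDr; apply: le_trans.
by rewrite -[m.+1]addn1 natrD exprD expr1 le_eqVlt; apply/orP; left; apply/eqP; ring.
Qed.

(** For fixed [y] the values of [f] are chosen independently, so the number of admissible [f] is the
    [#|K|]-th power of the number of admissible [x]; the power mean over [y] concludes. *)
Lemma dense_ffuns (R : realFieldType) (X Y K : finType) (P : X -> Y -> bool) (c : R) :
  0 <= c -> c * #|X|%:R * #|Y|%:R <= \sum_y \sum_x (P x y)%:R ->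
  c ^+ #|K| * #|{ffun K -> X}|%:R * #|Y|%:R
    <= \sum_y \sum_(f : {ffun K -> X}) [forall k, P (f k) y]%:R.
Proof.
move=> c0 le_cP; rewrite card_ffun natrX -exprMn.
have -> : \sum_y \sum_(f : {ffun K -> X}) [forall k, P (f k) y]%:R
          = \sum_y (\sum_x (P x y)%:R) ^+ #|K| :> R.
  apply: eq_bigr => y _; rewrite -!natr_sum -natrX; congr _%:R.
  rewrite -!big_mkcond !sum1_card -card_ffun_on; apply: eq_card => f.
  by apply/forallP/ffun_onP.
apply: sum_expr_ge => //; first by rewrite mulr_ge0.
by move=> y; apply: sumr_ge0.
Qed.

(** * Sets in which one coordinate is determined by the others *)

Definition ffun_set (X : finType) (Y : Type) (f : {ffun X -> Y}) (x : X) (a : Y) :=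
  [ffun z => if z == x then a else f z].

Lemma ffun_set_inj (X : finType) (Y : Type) (f g : {ffun X -> Y}) (x : X) (a b : Y) :
  ffun_set f x a = ffun_set g x b -> a = b /\ forall z, z != x -> f z = g z.
Proof.
move=> /ffunP E; split=> [|z zx]; first by have := E x; rewrite !ffunE eqxx.
by have := E z; rewrite !ffunE (negbTE zx).
Qed.

(** Overwriting a determined coordinate by an arbitrary element of [A] loses nothing, so [B] times
    [A] injects into [P]. *)
Lemma card_determined (P A : finType) (upd : P -> A -> P) (B : {set P}) :
  (forall p q a b, p \in B -> q \in B -> upd p a = upd q b -> p = q /\ a = b) ->
  (#|B| * #|A| <= #|P|)%N.
Proof.
move=> updI; rewrite -[#|A|]cardsT -cardsX.
rewrite -(card_in_imset (f := fun pa => upd pa.1 pa.2)) ?max_card //.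
move=> [p a] [q b]; rewrite !in_setX /= => /andP[pB _] /andP[qB _] E.
by have [-> ->] := updI _ _ _ _ pB qB E.
Qed.


Lemma sum_pair (R : nmodType) (X Y : finType) (F : X * Y -> R) :
  \sum_p F p = \sum_x \sum_y F (x, y).
Proof. by rewrite pair_bigA; apply: eq_bigr => -[]. Qed.

(** * Grids: sizes, collisions and fibers *)

Section Grids.
Variables (A : finGroupType) (I J K : finType).

(* Ordered as (y, (x, d)). *)
Definition grid_params := ({ffun J -> A} * ({ffun I -> A} * {ffun K -> A}))%type.

Implicit Type p : grid_params.

Definition leaf p (u : I * K + J * K) : A :=
  match u with
  | inl ik => (p.2.1 ik.1 * p.2.2 ik.2)%g
  | inr jk => (p.1 jk.1 * (p.2.2 jk.2)^-1)%g
  end.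

(** When [A] is abelian the shift cancels, and the third coordinate is the product of the first
    two. *)
Definition cell p (w : I * J * K) : triple A :=
  (leaf p (inl (w.1.1, w.2)), leaf p (inr (w.1.2, w.2)),
   (p.2.1 w.1.1 * p.1 w.1.2)%g).

Definition grid p : {set triple A} := [set cell p w | w in setT].

Lemma card_grid p : injective (leaf p) -> #|grid p| = (#|I| * #|J| * #|K|)%N.
Proof.
move=> lI; rewrite card_imset ?cardsT ?card_prod //.
move=> [[i j] k] [[i' j'] k'] E.
have [-> ->] := lI _ _ (congr1 (fun s : triple A => s.1.1) E).
by have [->] := lI _ _ (congr1 (fun s : triple A => s.1.2) E).
Qed.

Lemma card_elements_grid_le p :
  (#|elements (grid p)| <= (#|I| + #|J|) * #|K| + #|I| * #|J|)%N.
Proof.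
set U := [set leaf p u | u in setT].
set V := [set (p.2.1 ij.1 * p.1 ij.2)%g | ij in [set: I * J]].
have sUV : elements (grid p) \subset U :|: V.
  apply/bigcupsP => s /imsetP[w _ ->]; apply/subsetP => a.
  rewrite !inE -orbA => /or3P[] /eqP->; apply/orP.
  - by left; apply: imset_f.
  - by left; apply: imset_f.
  - by right; apply: (imset_f (fun ij : I * J => (p.2.1 ij.1 * p.1 ij.2)%g) (in_setT w.1)).
apply: leq_trans (subset_leq_card sUV) _; apply: leq_trans (leq_card_setU _ _) _.
apply: leq_add; apply: leq_trans (leq_imset_card _ _) _.
  by rewrite cardsT card_sum !card_prod mulnDl.
by rewrite cardsT card_prod.
Qed.

Lemma leaf_elements p (i0 : I) (j0 : J) u : leaf p u \in elements (grid p).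
Proof.
case: u => [[i k]|[j k]]; apply/bigcupP.
  by exists (cell p (i, j0, k)); rewrite ?imset_f // !inE eqxx.
by exists (cell p (i0, j, k)); rewrite ?imset_f // !inE eqxx orbT.
Qed.

(** Only leaves are counted: a product of some [x i] and [y j] may coincide with another product or
    with a leaf. *)
Lemma card_elements_grid_ge p (i0 : I) (j0 : J) :
  injective (leaf p) -> ((#|I| + #|J|) * #|K| <= #|elements (grid p)|)%N.
Proof.
move=> lI; rewrite mulnDl -!card_prod -card_sum -cardsT -(card_imset _ lI).
by apply/subset_leq_card/subsetP => _ /imsetP[u _ ->]; apply: leaf_elements.
Qed.

(** An equation between two distinct leaves can be solved for one value of [x], [y] or [d] in terms
    of the others. *)
Lemma card_leaf_collision u v : u != v ->
  (#|[set p | leaf p u == leaf p v]| * #|A| <= #|{: grid_params}|)%N.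
Proof.
have rowP (i : I) (B : {set grid_params}) :
    (forall y x x' d, (y, (x, d)) \in B -> (y, (x', d)) \in B ->
       (forall z, z != i -> x z = x' z) -> x i = x' i) ->
    (#|B| * #|A| <= #|{: grid_params}|)%N.
  move=> H; apply: (card_determined
    (upd := fun p a => (p.1, (ffun_set p.2.1 i a, p.2.2)))).
  move=> [y [x d]] [y' [x' d']] a b pB qB /= [Ey Ex Ed]; subst y' d'.
  have [-> E] := ffun_set_inj Ex; split=> //; congr (_, (_, _)).
  by apply/ffunP => z; have [->|/E//] := eqVneq z i; apply: (H y x x' d).
have colP (j : J) (B : {set grid_params}) :
    (forall y y' x d, (y, (x, d)) \in B -> (y', (x, d)) \in B ->
       (forall z, z != j -> y z = y' z) -> y j = y' j) ->
    (#|B| * #|A| <= #|{: grid_params}|)%N.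
  move=> H; apply: (card_determined
    (upd := fun p a => (ffun_set p.1 j a, p.2))).
  move=> [y [x d]] [y' [x' d']] a b pB qB /= [Ey Ex Ed]; subst x' d'.
  have [-> E] := ffun_set_inj Ey; split=> //; congr (_, _).
  by apply/ffunP => z; have [->|/E//] := eqVneq z j; apply: (H y y' x d).
have shiftP (k : K) (B : {set grid_params}) :
    (forall y x d d', (y, (x, d)) \in B -> (y, (x, d')) \in B ->
       (forall z, z != k -> d z = d' z) -> d k = d' k) ->
    (#|B| * #|A| <= #|{: grid_params}|)%N.
  move=> H; apply: (card_determined
    (upd := fun p a => (p.1, (p.2.1, ffun_set p.2.2 k a)))).
  move=> [y [x d]] [y' [x' d']] a b pB qB /= [Ey Ex Ed]; subst x' y'.
  have [-> E] := ffun_set_inj Ed; split=> //; congr (_, (_, _)).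
  by apply/ffunP => z; have [->|/E//] := eqVneq z k; apply: (H y x d d').
(* Solving for [x i] is safe because it occurs on one side only; for [k = k'] the equation would be
   quadratic in [d k]. *)
have mixed i k j k' :
    (#|[set p | leaf p (inl (i, k)) == leaf p (inr (j, k'))]| * #|A|
      <= #|{: grid_params}|)%N.
  apply: (rowP i) => y x x' d; rewrite !inE /= => /eqP E1 /eqP E2 _.
  by apply: (mulIg (d k)); rewrite E1 E2.
case: u v => [[i k]|[j k]] [[i' k']|[j' k']] uv //.
- have [ii|ii] := eqVneq i i'.
    subst i'; have kk : k' != k by apply: contra_neq uv => ->.
    apply: (shiftP k) => y x d d'; rewrite !inE /= => /eqP/mulgI E1 /eqP/mulgI E2 E.
    by rewrite E1 E2 E.
  apply: (rowP i) => y x x' d; rewrite !inE /= => /eqP E1 /eqP E2 E.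
  by apply: (mulIg (d k)); rewrite E1 E2 E // eq_sym.
- by rewrite (_ : [set p | _] = [set p | leaf p (inl (i', k')) == leaf p (inr (j, k))]);
    [exact: mixed | apply/setP=> p; rewrite !inE eq_sym].
- have [jj|jj] := eqVneq j j'.
    subst j'; have kk : k' != k by apply: contra_neq uv => ->.
    apply: (shiftP k) => y x d d'.
    rewrite !inE /= => /eqP/mulgI/invg_inj E1 /eqP/mulgI/invg_inj E2 E.
    by rewrite E1 E2 E.
  apply: (colP j) => y y' x d; rewrite !inE /= => /eqP E1 /eqP E2 E.
  by apply: (mulIg (d k)^-1%g); rewrite E1 E2 E // eq_sym.
Qed.

(* A grid determines its parameters up to the choice of one [d k0], since, when A is abelian,
   (y, (x, d)) and its translates (y s, (x s^-1, s d)) have the same leaves. *)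
Lemma card_grid_fiber (i0 : I) (j0 : J) (k0 : K) (T : {set triple A}) :
  (#|[set p | grid p == T]| <= #|A| * #|elements T| ^ (#|I| + #|J| + #|K|))%N.
Proof.
(* Once [d k0] is known, the leaves over [k0] give back [x] and [y], and then those of row [i0] give
   back [d]. *)
pose enc p : A * {ffun (I + J) + K -> A} :=
  (p.2.2 k0, [ffun w => leaf p match w with
     | inl (inl i) => inl (i, k0) | inl (inr j) => inr (j, k0)
     | inr k => inl (i0, k) end]).
have encI : injective enc.
  move=> [y [x d]] [y' [x' d']] [/= d0 /ffunP E].
  have Ex : x = x'.
    by apply/ffunP => i; have := E (inl (inl i)); rewrite !ffunE /= d0 => /mulIg.
  have Ey : y = y'.
    by apply/ffunP => j; have := E (inl (inr j)); rewrite !ffunE /= d0 => /mulIg.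
  subst x' y'; congr (_, (_, _)); apply/ffunP => k.
  by have := E (inr k); rewrite !ffunE /= => /mulgI.
rewrite -(card_imset _ encI) -!card_sum -card_ffun_on -[#|A|]cardsT.
rewrite -(cardsE (ffun_on _)) -cardsX; apply/subset_leq_card/subsetP.
move=> z /imsetP[p]; rewrite inE => /eqP <- ->{z}; rewrite in_setX !inE /=.
apply/ffun_onP => w; rewrite ffunE; exact: leaf_elements.
Qed.

(** * Counting grids inside a dense set of triples *)

Lemma dense_grids (R : realFieldType) (S0 : {set triple A}) (c : R) :
  0 <= c -> abelian [set: A] -> S0 \subset mul_triples A ->
  c * #|A|%:R ^+ 2 <= #|S0|%:R ->
  c ^+ (#|I| * #|J| * #|K|) * #|{: grid_params}|%:R
    <= #|[set p | grid p \subset S0]|%:R.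
Proof.
move=> c0 abA sS le_cS.
have mulC (a b : A) : commute a b by apply: (centsP abA); rewrite in_setT.
pose P1 (d : A) (xy : A * A) := ((xy.1 * d)%g, (xy.2 * d^-1)%g, (xy.1 * xy.2)%g) \in S0.
have H1 : c * #|A|%:R * #|{: A * A}|%:R <= \sum_xy \sum_d (P1 d xy)%:R.
  (* Each [d] contributes at least [#|S0|]: a triple [(a, b, a b)] of [S0] is reached from the pair
     [(a d^-1, b d)]. *)
  rewrite exchange_big /=; have le_d (d : A) : (#|S0|%:R <= \sum_xy (P1 d xy)%:R :> R).
    rewrite -natr_sum ler_nat -big_mkcond sum1_card.
    pose h (xy : A * A) := ((xy.1 * d)%g, (xy.2 * d^-1)%g, (xy.1 * xy.2)%g).
    apply: leq_trans (leq_imset_card h _); apply/subset_leq_card/subsetP => s sS0.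
    have /imsetP[[a b] _ /= Es] := subsetP sS _ sS0.
    have Eh : h (a * d^-1, b * d)%g = s.
      by rewrite /h /= mulgKV mulgK Es (mulC b d) mulgA mulgKV.
    by rewrite -Eh; apply: imset_f; rewrite unfold_in /P1 -/(h (_, _)) Eh.
  apply: le_trans (ler_sum _ (fun d _ => le_d d)).
  rewrite sumr_const card_prod natrM -[X in _ <= X]mulr_natr.
  have := ler_wpM2r (ler0n R #|A|) le_cS; apply: le_trans.
  by rewrite le_eqVlt; apply/orP; left; apply/eqP; rewrite expr2; ring.
(* Each cloning treats one variable and keeps the others, cloned or not, fixed. The density becomes
   [c ^ #|K|], which is then raised to the powers [#|I|] and [#|J|]. *)
pose P2 (x : A) (yd : A * {ffun K -> A}) := [forall k, P1 (yd.2 k) (x, yd.1)].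
have H2 : c ^+ #|K| * #|A|%:R * #|{: A * {ffun K -> A}}|%:R
    <= \sum_yd \sum_x (P2 x yd)%:R.
  have := @dense_ffuns _ _ _ K P1 c c0 H1.
  rewrite !sum_pair => H.
  rewrite [X in _ <= X](eq_bigr (fun y => \sum_x \sum_(d : {ffun K -> A}) (P2 x (y, d))%:R)).
    rewrite exchange_big /=; apply: le_trans H.
    by rewrite !card_prod !natrM le_eqVlt; apply/orP; left; apply/eqP; ring.
  by move=> y _; rewrite exchange_big.
have cK0 := exprn_ge0 #|K| c0.
pose P3 (y : A) (xd : {ffun I -> A} * {ffun K -> A}) :=
  [forall i, P2 (xd.1 i) (y, xd.2)].
have H3 : (c ^+ #|K|) ^+ #|I| * #|A|%:R * #|{: {ffun I -> A} * {ffun K -> A}}|%:R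
    <= \sum_xd \sum_y (P3 y xd)%:R.
  have := @dense_ffuns _ _ _ I P2 _ cK0 H2.
  rewrite !sum_pair => H.
  rewrite exchange_big /=.
  rewrite [X in _ <= X](eq_bigr (fun d => \sum_y \sum_(x : {ffun I -> A}) (P3 y (x, d))%:R)).
    rewrite exchange_big /=; apply: le_trans H.
    by rewrite !card_prod !natrM le_eqVlt; apply/orP; left; apply/eqP; ring.
  by move=> d _; rewrite exchange_big.
have := @dense_ffuns _ _ _ J P3 _ (exprn_ge0 #|I| cK0) H3.
rewrite -!exprM [(#|K| * _)%N]mulnC mulnAC => H.
rewrite [#|{: grid_params}|]card_prod natrM mulrA.
apply: le_trans H _; rewrite exchange_big pair_bigA -natr_sum ler_nat.
rewrite -big_mkcond sum1_card; apply/subset_leq_card/subsetP => -[y [x d]].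
rewrite !inE /= => /forallP H; apply/subsetP => _ /imsetP[[[i j] k] _ ->].
by have /forallP/(_ i)/forallP/(_ k) := H j.
Qed.

(** Let [n = #|A|] and [D = #|I| + #|J| + #|K|]. From the dense parameters remove the colliding
    ones, at most [n ^ (D - 1)] per pair of leaves, and divide by the fiber bound [n * M ^ D]. A
    further factor [n] on both sides avoids the exponent [D - 1]. *)
Lemma count_grids (R : realFieldType) (i0 : I) (j0 : J) (k0 : K)
    (S0 : {set triple A}) (c : R) (M : nat) (F : {set {set triple A}}) :
  0 <= c -> abelian [set: A] -> S0 \subset mul_triples A ->
  c * #|A|%:R ^+ 2 <= #|S0|%:R ->
  (forall p, injective (leaf p) -> grid p \subset S0 -> grid p \in F) ->
  (forall T, T \in F -> (#|elements T| <= M)%N) ->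
  (c ^+ (#|I| * #|J| * #|K|) * #|A|%:R - (#|{: I * K + J * K}| ^ 2)%:R)
      * #|A|%:R ^+ (#|I| + #|J| + #|K|)
    <= #|F|%:R * M%:R ^+ (#|I| + #|J| + #|K|) * #|A|%:R ^+ 2.
Proof.
move=> c0 abA sS le_cS gridF leM.
have := dense_grids c0 abA sS le_cS.
have -> : #|{: grid_params}| = (#|A| ^ (#|I| + #|J| + #|K|))%N.
  by rewrite !card_prod !card_ffun -!expnD addnA [(#|J| + _)%N]addnC.
set D := (#|I| + #|J| + #|K|)%N; set dlt := c ^+ _; set G := [set p | _] => dense.
have D_gt0 : (0 < D)%N.
  by rewrite addn_gt0 orbC; apply/orP; left; apply/card_gt0P; exists k0.
pose coll (uv : (I * K + J * K) * (I * K + J * K)) :=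
  [set p | leaf p uv.1 == leaf p uv.2].
pose good := [set p in G | [forall uv, (p \in coll uv) ==> (uv.1 == uv.2)]].
have le_good : (#|good| <= #|F| * (#|A| * M ^ D))%N.
  rewrite -sum1_card (partition_big (@grid) (mem F)) /=.
    rewrite -sum_nat_const; apply: leq_sum => T TF; rewrite sum1_card.
    apply: (@leq_trans #|[set p | grid p == T]|).
      by apply/subset_leq_card/subsetP => p; rewrite !inE => /andP[_].
    apply: leq_trans (card_grid_fiber i0 j0 k0 T) _.
    by rewrite leq_mul2l leq_exp2r ?leM ?orbT.
  move=> p; rewrite !inE => /andP[pS /forallP inj].
  apply: gridF => // u v luv; apply/eqP.
  by have /implyP := inj (u, v); apply; rewrite inE luv.
have le_G : (#|G| * #|A| <= #|good| * #|A| + #|{: I * K + J * K}| ^ 2 * #|A| ^ D)%N.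
  have sG : G \subset good :|: \bigcup_(uv | uv.1 != uv.2) coll uv.
    apply/subsetP => p pG; rewrite in_setU [p \in good]inE pG /=.
    rewrite -implyNb negb_forall; apply/implyP => /existsP[uv].
    by rewrite negb_imply => /andP[pc uvN]; apply/bigcupP; exists uv.
  apply: (@leq_trans ((#|good| + \sum_(uv | uv.1 != uv.2) #|coll uv|) * #|A|)).
    rewrite leq_mul2r; apply/orP; right; apply: leq_trans (subset_leq_card sG) _.
    apply: leq_trans (leq_card_setU _ _) _; rewrite leq_add2l.
    elim/big_rec2: _ => [|uv k X _ leX]; first by rewrite cards0.
    by apply: leq_trans (leq_card_setU _ _) _; rewrite leq_add2l.
  rewrite mulnDl leq_add2l big_distrl /=.
  apply: (@leq_trans (\sum_(uv : (I * K + J * K) * (I * K + J * K)) #|A| ^ D)).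
    rewrite big_mkcond; apply: leq_sum => -[u v] _; case: ifP => // uv.
    apply: leq_trans (card_leaf_collision uv) _.
    by rewrite !card_prod !card_ffun -!expnD addnA [(#|J| + _)%N]addnC.
  by rewrite sum_nat_const card_prod.
have := leq_trans le_G (leq_add (leq_mul le_good (leqnn #|A|)) (leqnn _)).
rewrite -(ler_nat R) !(natrD, natrM, natrX) => H.
have := le_trans (ler_wpM2r (ler0n R #|A|) dense) H.
rewrite natrX -lerBlDr => H2.
apply: le_trans (le_trans H2 _); rewrite le_eqVlt; apply/orP; left; apply/eqP; ring.
Qed.

End Grids.

(** * Choice of the sizes and conclusion *)

(** The third inequality is the required density at the largest possible number of elements, with
    denominators cleared. With sides 3, each shift brings 9 triples for 6 leaves, a ratio above 4/3.
    At [t = 2], sides 3 with [2 ^ t] shifts could span 33 elements, above the limit 22. *)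
Lemma grid_size (t : nat) : (2 <= t)%N ->
  exists r m : nat,
    [/\ (2 ^ t.+1 <= (r.+2 + r.+2) * m.+1)%N,
        ((r.+2 + r.+2) * m.+1 + r.+2 * r.+2 <= 4 ^ t + 3 * t)%N &
        (4 * (4 ^ t - 1) * ((r.+2 + r.+2) * m.+1 + r.+2 * r.+2)
           <= 3 * 4 ^ t * (r.+2 * r.+2 * m.+1) + 4 * (4 ^ t - 1) * (3 * t))%N].
Proof.
case: t => [|[|[|t]]] // _; first by exists 0%N, 1%N.
have e2 : (0 < 2 ^ t)%N by rewrite expn_gt0.
have e4 : (4 ^ t = 2 ^ t * 2 ^ t)%N by rewrite -expnMn.
exists 1%N, (8 * 2 ^ t).-1; rewrite prednK ?muln_gt0 //.
rewrite !expnS e4; set q := (2 ^ t)%N in e2 *.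
by split; nia.
Qed.

Theorem theorem3 (R : realType) (c : R) (t : nat) (hc : 0 < c)
    (ht : (2 <= t)%N) :
  exists2 mu : R, 0 < mu &
    forall (A : finGroupType) (S0 : {set triple A}),
      abelian [set: A] ->
      S0 \subset mul_triples A ->
      c * #|A|%:R ^+ 2 <= #|S0|%:R ->
      exists F : {set {set triple A}},
        Num.floor (mu * #|A|%:R ^+ 3) <= #|F|%:Z /\
        forall T : {set triple A}, T \in F ->
          exists nu : nat,
            (2 ^ t.+1 <= nu <= 4 ^ t + 3 * t)%N /\
            is_configuration S0 nu
              (4 * (nu%:R - 3 * t%:R) / 3 * (1 - 1 / 4 ^+ t) : R) T.
Proof.
have [r [m [le1 le2 le3]]] := grid_size ht.
set M := (4 ^ t + 3 * t)%N in le2 *.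
set D := (r.+2 + r.+2 + m.+1)%N.
set dlt := c ^+ (r.+2 * r.+2 * m.+1).
have dlt0 : 0 < dlt by rewrite exprn_gt0.
set L : R := (((r.+2 + r.+2) * m.+1) ^ 2)%:R.
have L0 : 0 < L by rewrite ltr0n expn_gt0 muln_gt0.
have M0 : 0 < M%:R ^+ D :> R.
  by rewrite exprn_gt0 // ltr0n addn_gt0 expn_gt0.
(* The first term serves [dlt * n >= 2 * L], where collisions cost at most half of the count; the
   second forces [mu * n ^ 3 < 1] for smaller [n]. *)
exists (Num.min (dlt / 2 / M%:R ^+ D) ((dlt / 2 / L) ^+ 3)).
  by rewrite lt_min exprn_gt0 !divr_gt0.
move=> A S0 abA sS le_cS; set mu := Num.min _ _; set n := #|A|.
pose bound (nu : nat) : R := 4 * (nu%:R - 3 * t%:R) / 3 * (1 - 1 / 4 ^+ t).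
pose F := [set T : {set triple A} | [&& T \subset S0,
  (2 ^ t.+1 <= #|elements T| <= M)%N & bound #|elements T| <= #|T|%:R]].
exists F; split; last first.
  by move=> T; rewrite inE => /and3P[TS leT bT]; exists #|elements T|.
have [n_ge|n_lt] := leP (L + L) (dlt * n%:R); last first.
  apply: (@le_trans _ _ 0) => //; rewrite real_floor_le0 ?num_real //.
  apply: (@le_lt_trans _ _ ((dlt / 2 / L * n%:R) ^+ 3)).
    by rewrite exprMn ler_wpM2r ?exprn_ge0 // ge_min lexx orbT.
  rewrite exprn_ilt1 // ?mulr_ge0 ?invr_ge0 ?(ltW L0) ?(ltW dlt0) //.
  by rewrite -mulrA [L^-1 * _]mulrC mulrA ltr_pdivrMr // mul1r; lra.
have gridF (p : grid_params A 'I_r.+2 'I_r.+2 'I_m.+1) :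
    injective (leaf p) -> grid p \subset S0 -> grid p \in F.
  move=> lI gS; rewrite inE gS card_grid // !card_ord.
  have := card_elements_grid_ge (ord0 : 'I_r.+2) (ord0 : 'I_r.+2) lI.
  have := card_elements_grid_le p; rewrite !card_ord => eU eL.
  rewrite (leq_trans le1 eL) (leq_trans eU le2) /=.
  set nu := #|_| in eU eL *; rewrite /bound; set q : R := 4 ^+ t.
  have q0 : 0 < q by rewrite exprn_gt0.
  have q1 : 1 <= q by rewrite exprn_ege1 // ler1n.
  have -> : 4 * (nu%:R - 3 * t%:R) / 3 * (1 - 1 / q)
            = 4 * (q - 1) * (nu%:R - 3 * t%:R) / (3 * q).
    by field; rewrite gt_eqF.
  rewrite ler_pdivrMr ?mulr_gt0 //.
  (* The required bound grows with [nu], so the case of the largest [nu] suffices. *)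
  have := leq_trans (leq_mul (leqnn (4 * (4 ^ t - 1))) eU) le3.
  rewrite -(ler_nat R) !(natrD, natrM) natrB ?expn_gt0 // !natrX -/q.
  lra.
have := count_grids ord0 ord0 ord0 (ltW hc) abA sS le_cS gridF.
move=> /(_ M); rewrite card_sum !card_prod !card_ord -mulnDl -/D -/dlt -/L -/n => H.
have {H} H : (dlt * n%:R - L) * n%:R ^+ D <= #|F|%:R * M%:R ^+ D * n%:R ^+ 2.
  by apply: H => T; rewrite inE => /and3P[_ /andP[]].
rewrite -(ler_int R) -pmulrn.
apply: le_trans (real_floor_le (num_real _)) _.
have n1 : 1 <= n%:R :> R by rewrite ler1n; apply/card_gt0P; exists 1%g.
have n0 : 0 < n%:R :> R by apply: lt_le_trans n1.
apply: (@le_trans _ _ (dlt / 2 / M%:R ^+ D * n%:R ^+ 3)).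
  by rewrite ler_wpM2r ?exprn_ge0 // ge_min lexx.
rewrite -mulrA [_^-1 * _]mulrC mulrA ler_pdivrMr //.
rewrite -(ler_pM2r (exprn_gt0 2 n0)); apply: le_trans H.
apply: (@le_trans _ _ (dlt / 2 * n%:R * n%:R ^+ D)); last first.
  by rewrite ler_wpM2r ?exprn_ge0 //; lra.
rewrite -[X in X <= _]mulrA -[X in _ <= X]mulrA -exprD -exprS ler_wpM2l ?divr_ge0
  ?(ltW dlt0) ?invr_ge0 //.
(* The exponents compared are 5 and [D + 1], and [D] is at least 5. *)
by apply: ler_weXn2l => //; rewrite /D; lia.
Qed.
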